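(* Let $\{f(\cdot;\theta):\theta\in\Theta\}$ be a family of probability density functions of the form $f(x;\theta)=f_0(x)\exp[b(\theta)x]\,h(\theta)$, each with support $(0,\infty)$ (so $f_0>0$ on $(0,\infty)$ and $h>0$). Let $\mu$ be a probability distribution on $\Theta$ and let $g(x)=\int f(x;t)\,d\mu(t)$ be the corresponding mixture density. Fix $\theta\in\Theta$, let $X$ and $Y$ be random variables with densities $f(\cdot;\theta)$ and $g$ respectively, and let $l(x)=\log(f(x;\theta)/g(x))$, $x>0$. 1. Suppose that $\lim_{x\downarrow0}l(x)=-\log\left(\int \frac{h(t)}{h(\theta)}\,d\mu(t)\right)$ (interchange of limit and integration is valid). Then $X\leq_{st}Y$ if and only if $\int h(t)\,d\mu(t)\leq h(\theta)$; likewise, $X\leq_{hr}Y$ if and only if $\int h(t)\,d\mu(t)\leq h(\theta)$. 2. Suppose that $\int h\,d\mu$ and $\int |b|h\,d\mu$ are finite and $\lim_{x\downarrow0}l'(x)=\frac{\int[b(\theta)-b(t)]h(t)\,d\mu(t)}{\int h(t)\,d\mu(t)}$ (interchange of limit/differentiation and integration is valid). Then $X\leq_{lr}Y$ if and only if $$b(\theta)\leq\frac{\int b(t)h(t)\,d\mu(t)}{\int h(t)\,d\mu(t)};$$ likewise, $X\leq_{rh}Y$ if and only if the same inequality holds.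
   Context: $b$ and $h$ are real-valued measurable functions on the measurable parameter space $\Theta$. Densities are taken in the versions given by the formulas above. The convention $-\log\infty=-\infty$ is used. Let $X,Y$ have pdfs $f,g$ supported on $(0,\infty)$ and cumulative distribution functions $F,G$, and put $\bar F=1-F$, $\bar G=1-G$. Usual stochastic order: $X\leq_{st}Y$ if $\bar F(x)\leq\bar G(x)$ for all $x$. Hazard rate order: $X\leq_{hr}Y$ if $f(x)/\bar F(x)\geq g(x)/\bar G(x)$ for all $x>0$. Reversed hazard rate order: $X\leq_{rh}Y$ if $f(x)/F(x)\leq g(x)/G(x)$ for all $x>0$. Likelihood ratio order: $X\leq_{lr}Y$ if $f(x)/g(x)$ is a monotone decreasing (i.e. non-increasing) function on $(0,\infty)$. *)

(* Defs.v *)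
From HB Require Import structures.
From mathcomp Require Import all_boot all_order all_algebra.
From mathcomp Require Import all_classical all_reals all_analysis.

Set Implicit Arguments.
Unset Strict Implicit.
Unset Printing Implicit Defensive.

Import Order.TTheory GRing.Theory Num.Theory.
Import numFieldNormedType.Exports.

Local Open Scope classical_set_scope.
Local Open Scope ring_scope.

Definition is_pdf (R : realType) (f : R -> R) : Prop :=
  [/\ measurable_fun [set: R] f, forall x, 0 <= f x &
      (\int[@lebesgue_measure R]_x (f x)%:E = 1)%E].

Definition has_pdf (R : realType) d (Omega : measurableType d)
    (P : probability Omega R) (X : {RV P >-> R}) (f : R -> R) : Prop :=
  forall A : set R, measurable A ->
    distribution P X A = (\int[@lebesgue_measure R]_(x in A) (f x)%:E)%E.

Section orders.
Context (R : realType) (d1 d2 : measure_display).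
Context (Omega1 : measurableType d1) (Omega2 : measurableType d2).
Context (P1 : probability Omega1 R) (P2 : probability Omega2 R).
Implicit Types (X : {RV P1 >-> R}) (Y : {RV P2 >-> R}) (f g : R -> R).

Definition st_le X Y : Prop := forall x : R, (ccdf X x <= ccdf Y x)%E.

(* The hazard rate, reversed hazard rate and likelihood ratio orders are
   pointwise conditions on densities, so the version of each density is an
   argument. For densities that are positive exactly on ]0, +oo[, the
   denominators below are nonzero at every x > 0. *)
Definition hr_le X f Y g : Prop :=
  forall x : R, 0 < x -> f x / fine (ccdf X x) >= g x / fine (ccdf Y x).

Definition rh_le X f Y g : Prop :=
  forall x : R, 0 < x -> f x / fine (cdf X x) <= g x / fine (cdf Y x).

End orders.

Definition lr_le (R : realType) (f g : R -> R) : Prop :=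
  {in `]0, +oo[ &, nonincreasing_fun (fun x : R => f x / g x)}.

Definition expfam (R : realType) (Theta : Type) (f0 : R -> R)
    (b h : Theta -> R) (t : Theta) (x : R) : R :=
  f0 x * expR (b t * x) * h t.

(* The integral is real-valued, hence 0 where the extended integral is +oo.
   When every expfam f0 b h t is a probability density positive exactly on
   ]0, +oo[, this does not happen: the extended integral is f0 x times a convex
   function of x > 0 which, by Tonelli, is finite almost everywhere there. *)
Definition mixture (R : realType) d (Theta : measurableType d)
    (mu : probability Theta R) (f : Theta -> R -> R) (x : R) : R :=
  \int[mu]_t f t x.

Definition logratio (R : realType) (f g : R -> R) (x : R) : R :=
  ln (f x / g x).

(* Main.v *)
Require Import Defs.
From HB Require Import structures.
From mathcomp Require Import all_boot all_order all_algebra.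
From mathcomp Require Import all_classical all_reals all_analysis.
From mathcomp Require Import measurable_realfun.
From mathcomp Require Import ring lra.

Set Implicit Arguments.
Unset Strict Implicit.
Unset Printing Implicit Defensive.

Import Order.TTheory GRing.Theory Num.Theory.
Import numFieldNormedType.Exports.

Local Open Scope classical_set_scope.
Local Open Scope ring_scope.

(** Write [w = g / f] for the ratio of the mixture density to the fixed density.
Dividing by [f = f(. ; theta)] cancels [f0], so that on the positive half-line
[w x = \int exp ((b t - b theta) x) h t / h theta dmu], an integral of
exponentials and hence a convex function ([tilt_integral_tangent]). All four
orders are statements about [w]: with [F], [G] the distribution functions and
[F'], [G'] the survival functions, [X <=st Y] means [F' <= G'], [X <=hr Y]
means [w F' <= G'], [X <=rh Y] means [G <= w F], and [X <=lr Y] means that [w]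
is nondecreasing. Since [g = w f], a bound on [w] over a half-line compares the
probabilities of that half-line ([prob_le], [prob_lt]).

For the first part, [l = - ln w] and the assumption says that
[w x --> w0 = \int h dmu / h theta] as [x --> 0+]. If [w0 <= 1], convexity gives
[w z <= max 1 (w y)] for [z < y] ([le_max_of_near_le]). Now fix [x]. For the
usual stochastic order, either [w >= 1] on all of [(x, +oo)], and then
[F' x <= G' x] by integrating there, or [w y < 1] for some [y > x], and then
[w <= 1] on [(0, x]], whence [G x <= F x]. The same alternative with [w x] in
the place of [1] proves the hazard rate order ([st_hr_of_le_max]). If [w0 > 1],
then [w > 1] near 0, so [G' x < F' x] for small [x], which contradicts both
orders ([not_st_hr_of_near_gt1]).

For the second part, [l' = - w' / w] tends to a limit [L] whose sign is that of
[b theta - \int b h dmu / \int h dmu]. If [w] decreases somewhere, then [w'] is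
below a negative constant near 0 by convexity, while [w] stays bounded there
because [\int h dmu] is finite, so that [L > 0]; hence [L <= 0] makes [w]
nondecreasing, which yields both orders. Conversely a nondecreasing [w]
gives [L <= 0], and [L > 0] makes [w] decreasing near 0, which contradicts
[G <= w F].

That the integral defining [w] converges at every [x > 0] is not automatic: by
Tonelli's theorem the mixture has total mass 1, so the integral converges for
almost every [x > 0], and it converges between two such points by monotonicity
of the exponential ([integrable_tilt]). *)

(** * Integrals of exponentials *)

Lemma expR_mul_le_ends (R : realType) (s x y z : R) : x <= y -> y <= z ->
  expR (s * y) <= expR (s * x) + expR (s * z).
Proof.
move=> xy yz; have [s0|s0] := leP 0 s.
  by rewrite ler_wpDl ?expR_ge0// ler_expR ler_wpM2l.
by rewrite ler_wpDr ?expR_ge0// ler_expR ler_wnM2l// ltW.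
Qed.

(** Since [eps * `|s| <= expR (eps * `|s|)], a linear factor costs only a shift
of the exponent by [eps]; this dominates the derivative of [expR (s * x)] in [x]
by values of the exponential at two fixed points. *)
Lemma norm_expR_mul_le_ends (R : realType) (eps s p x q : R) : 0 < eps ->
  p + eps <= x -> x + eps <= q ->
  `|s| * expR (s * x) <= eps^-1 * (expR (s * p) + expR (s * q)).
Proof.
move=> e0 px xq; rewrite ler_pdivlMl// mulrA.
have h : eps * `|s| <= expR (eps * `|s|).
  by apply: le_trans (expR_ge1Dx _); rewrite lerDr.
apply: le_trans (ler_wpM2r (expR_ge0 _) h) _; rewrite -expRD.
have [s0|s0] := leP 0 s.
  rewrite ler_wpDl ?expR_ge0// ler_expR ger0_norm//.
  by rewrite mulrC -mulrDr ler_wpM2l// addrC.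
rewrite ler_wpDr ?expR_ge0// ler_expR ltr0_norm// mulrN mulrC -mulrN -mulrDr.
by rewrite ler_wnM2l ?(ltW s0)//; lra.
Qed.

Lemma norm_dexpR_mul_le_ends (R : realType) (eps s k p x q : R) : 0 < eps ->
  0 < k -> p + eps <= x -> x + eps <= q ->
  `|s * (expR (s * x) * k)| <=
    eps^-1 * (expR (s * p) * k + expR (s * q) * k).
Proof.
move=> e0 k0 px xq; rewrite mulrA normrM (gtr0_norm k0) -mulrDl mulrA.
apply: ler_wpM2r; first exact: ltW.
by rewrite normrM (gtr0_norm (expR_gt0 _)); exact: norm_expR_mul_le_ends.
Qed.

(** The exponential tilting of the weight [k] along the statistic [c]; the
integral below is the Laplace transform of the tilted weight. *)
Definition tilt (R : realType) (T : Type) (c k : T -> R) (x : R) (t : T) : R :=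
  expR (c t * x) * k t.

Definition tilt_integral (R : realType) (d : measure_display)
    (T : measurableType d) (mu : {measure set T -> \bar R}) (c k : T -> R)
    (x : R) : R :=
  \int[mu]_t tilt c k x t.

Definition tilt_slope (R : realType) (d : measure_display)
    (T : measurableType d) (mu : {measure set T -> \bar R}) (c k : T -> R)
    (x : R) : R :=
  \int[mu]_t (c t * tilt c k x t).

Section exponential_integral.
Context (R : realType) (d : measure_display) (T : measurableType d).
Context (mu : {measure set T -> \bar R}) (c k : T -> R).
Hypothesis c_meas : measurable_fun [set: T] c.
Hypothesis k_meas : measurable_fun [set: T] k.
Hypothesis k_gt0 : forall t, 0 < k t.

Local Notation e := (tilt c k).
Local Notation w := (tilt_integral mu c k).
Local Notation dw := (tilt_slope mu c k).

Lemma tilt_gt0 x t : 0 < e x t.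
Proof. by rewrite mulr_gt0 ?expR_gt0. Qed.

Let e_ge0 x t : 0 <= e x t. Proof. exact/ltW/tilt_gt0. Qed.

Lemma measurable_tilt x : measurable_fun [set: T] (e x).
Proof.
apply: measurable_funM => //; apply: measurableT_comp => //.
by apply: measurable_funM => //; exact: measurable_cst.
Qed.

Lemma integrable_tilt_itv x y z : x <= y -> y <= z ->
  mu.-integrable [set: T] (EFin \o e x) ->
  mu.-integrable [set: T] (EFin \o e z) ->
  mu.-integrable [set: T] (EFin \o e y).
Proof.
move=> xy yz ix iz; apply: le_integrable (integrableD _ ix iz) => //.
  exact/measurable_EFinP/measurable_tilt.
move=> t _ /=; rewrite lee_fin !ger0_norm ?addr_ge0 ?e_ge0//.
by rewrite /tilt -mulrDl ler_pM2r// expR_mul_le_ends.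
Qed.

Hypothesis e_int : forall x : R, 0 < x -> mu.-integrable [set: T] (EFin \o e x).

Lemma integrable_tilt_bound (C x z : R) : 0 < x -> 0 < z ->
  mu.-integrable [set: T] (EFin \o (fun t => C * (e x t + e z t))).
Proof.
move=> x0 z0.
have ixz := integrableD measurableT (e_int x0) (e_int z0).
have := integrableZl measurableT C ixz.
by apply: eq_integrable => // t _ /=; rewrite EFinM EFinD.
Qed.

Lemma integrable_tilt_slope (x : R) : 0 < x ->
  mu.-integrable [set: T] (EFin \o (fun t => c t * e x t)).
Proof.
move=> x0; have x20 : 0 < x / 2 by rewrite divr_gt0.
have xx0 : 0 < 2 * x by rewrite mulr_gt0.
apply: le_integrable (integrable_tilt_bound (x / 2)^-1 x20 xx0) => //.
  by apply/measurable_EFinP/measurable_funM => //; exact: measurable_tilt.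
move=> t _ /=; rewrite lee_fin [leRHS]ger0_norm; last first.
  by rewrite mulr_ge0 ?invr_ge0 ?(ltW x20)// addr_ge0.
by apply: norm_dexpR_mul_le_ends => //; lra.
Qed.

(** The tangent at [x] lies below the graph: integrate [1 + s <= expR s] with
[s = c t * (y - x)] against the tilted weight. *)
Lemma tilt_integral_tangent (x y : R) : 0 < x -> 0 < y ->
  w x + dw x * (y - x) <= w y.
Proof.
move=> x0 y0; rewrite /tilt_integral /tilt_slope -RintegralZr//; last first.
  exact: integrable_tilt_slope.
have i2 : mu.-integrable [set: T] (EFin \o (fun t => c t * e x t * (y - x))).
  have := integrableZr measurableT (y - x) (integrable_tilt_slope x0).
  by apply: eq_integrable => // t _ /=; rewrite EFinM.
rewrite -RintegralD//; [|exact: e_int].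
apply: le_Rintegral => //; [|exact: e_int|].
  have := integrableD measurableT (e_int x0) i2.
  by apply: eq_integrable => // t _ /=; rewrite EFinD.
move=> t _; rewrite /tilt.
have -> : c t * y = c t * x + c t * (y - x) by ring.
rewrite expRD; set E := expR (c t * x).
have -> : E * k t + c t * (E * k t) * (y - x) =
  E * (1 + c t * (y - x)) * k t by ring.
by rewrite ler_pM2r// ler_pM2l ?expR_gt0// expR_ge1Dx.
Qed.

Let is_derive_e (x : R) t : is_derive x 1 (e^~ t) (c t * e x t).
Proof.
have -> : e^~ t = (k t) *: (expR \o (fun x => c t *: x)) :> (R -> R).
  by apply/funext => y; rewrite /tilt /= [RHS]/GRing.scale /= mulrC.
have h : is_derive x 1 (fun x : R => c t *: x) (c t *: 1) by apply: is_deriveZ.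
apply: is_derive_eq.
by rewrite /GRing.scale /= mulr1 /tilt; ring.
Qed.

(** Differentiation under the integral sign, the dominating function being the
one of [norm_dexpR_mul_le_ends]. *)
Lemma is_derive_tilt_integral (a : R) : 0 < a -> is_derive a 1 w (dw a).
Proof.
move=> a0.
pose G t := (a / 4)^-1 * (e (a / 4) t + e (3 * a) t).
have iG : mu.-integrable [set: T] (EFin \o G).
  by apply: integrable_tilt_bound; lra.
(* On the interval from a/2 to 2a, a margin of a/4 on both sides stays between
a/4 and 3a, where both end points give integrable tilts. *)
pose I := `](a / 2), (2 * a)[%classic.
have Ia : I a by rewrite /I /= in_itv /=; apply/andP; split; lra.
have pE x t : partial1of2 e x t = c t * e x t.
  by rewrite partial1of2E; exact: derive_val.
have G0 t : 0 <= G t.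
  by rewrite /G mulr_ge0 ?invr_ge0 ?addr_ge0//; lra.
have Gub x t : I x -> [set: T] t -> `|partial1of2 e x t| <= G t.
  rewrite /I /= in_itv /= => /andP[ax xa] _; rewrite pE.
  by apply: norm_dexpR_mul_le_ends => //; lra.
have intf x : I x -> mu.-integrable [set: T] (EFin \o e x).
  by rewrite /I /= in_itv /= => /andP[ax _]; apply: e_int; lra.
have derf x t : I x -> [set: T] t -> derivable (e^~ t) x 1.
  by move=> _ _; apply: ex_derive.
apply: DeriveDef.
  exact: (derivable_under_integral measurableT Ia intf derf G0 iG Gub).
rewrite -derive1E.
rewrite (differentiation_under_integral measurableT Ia intf derf G0 iG Gub).
by apply: eq_Rintegral => t _; rewrite pE.
Qed.

Lemma tilt_integral_bounded : mu.-integrable [set: T] (EFin \o k) ->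
  \forall x \near 0^'+, w x <= \int[mu]_t k t + w 1.
Proof.
move=> k_int; near=> x; have x0 : 0 < x by [].
have x1 : x <= 1 by near: x; exact: nbhs_right_le.
rewrite /tilt_integral -RintegralD//; last exact: e_int.
apply: le_Rintegral => //; first exact: e_int.
  have := integrableD measurableT k_int (e_int ltr01).
  by apply: eq_integrable => // t _ /=; rewrite EFinD.
move=> t _; rewrite /tilt -[X in _ <= X + _]mul1r -mulrDl ler_pM2r//.
rewrite -[X in X + _]expR0 -[X in expR X + _](mulr0 (c t)).
exact: expR_mul_le_ends (ltW x0) x1.
Unshelve. all: by end_near. Qed.

End exponential_integral.

(** * Functions lying above their tangents *)

Lemma near_right0_itv (R : realType) (P : R -> Prop) :
  (\forall x \near 0^'+, P x) -> exists2 eps, 0 < eps &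
    forall x, 0 < x -> x < eps -> P x.
Proof.
case=> eps /= eps0 H; exists eps => // x x0 xe; apply: H => //=.
by rewrite sub0r normrN gtr0_norm.
Qed.

Section supporting_lines.
Context (R : realType) (w dw : R -> R).
Hypothesis tangent :
  forall x y : R, 0 < x -> 0 < y -> w x + dw x * (y - x) <= w y.

Lemma tangent_slope_nondecreasing (x y : R) : 0 < x -> x <= y -> dw x <= dw y.
Proof.
move=> x0; rewrite le_eqVlt => /predU1P[->//|xy].
have y0 := lt_trans x0 xy.
have := tangent x0 y0; have := tangent y0 x0; nra.
Qed.

Lemma decrease_slope_lt0 (x y : R) : 0 < x -> x < y -> w y < w x -> dw x < 0.
Proof.
move=> x0 xy; have := tangent x0 (lt_trans x0 xy); nra.
Qed.

Lemma slope_lt0_decrease (x y : R) : 0 < x -> x < y -> dw y < 0 -> w y < w x.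
Proof.
move=> x0 xy; have := tangent (lt_trans x0 xy) x0; nra.
Qed.

(** If [w z] exceeded both [1] and [w y], the slope at [z] would be negative,
so [w] would be at least [w z > 1] on the whole interval from 0 to [z]. *)
Lemma le_max_of_near_le (z y : R) :
  (forall M, 1 < M -> ~ \forall x \near 0^'+, M <= w x) ->
  0 < z -> z < y -> w z <= Num.max 1 (w y).
Proof.
move=> near1 z0 zy; rewrite leNgt; apply/negP; rewrite gt_max => /andP[w1 wy].
apply: (near1 _ w1); near=> x.
have x0 : 0 < x by [].
have xz : x < z by near: x; exact: nbhs_right_lt.
have dz : dw z < 0 := decrease_slope_lt0 z0 zy wy.
by apply/ltW/slope_lt0_decrease.
Unshelve. all: by end_near. Qed.

Hypothesis w_gt0 : forall x : R, 0 < x -> 0 < w x.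
Context (L : R).
Hypothesis dlog_cvg : - (dw x / w x) @[x --> 0^'+] --> L.

(** A decrease of [w] somewhere makes [dw x < 0] for some [x]; to the left of
[x] the slopes are at most [dw x] and [w] is at most [M], so the limit [L] is at
least [- dw x / M > 0]. *)
Lemma nondecreasing_of_dlog_le0 (M : R) : (\forall x \near 0^'+, w x <= M) ->
  L <= 0 -> forall x y, 0 < x -> x <= y -> w x <= w y.
Proof.
move=> wM L0 x y x0; rewrite le_eqVlt => /predU1P[->//|xy].
rewrite leNgt; apply/negP => /(decrease_slope_lt0 x0 xy) dx.
have M0 : 0 < M.
  near (0 : R)^'+ => z; apply: (@lt_le_trans _ _ (w z)); first exact: w_gt0.
  by near: z.
suff : - dw x / M <= L.
  by move=> /le_trans/(_ L0); rewrite leNgt divr_gt0 ?oppr_gt0.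
apply: (cvgr_to_ge dlog_cvg); near=> z.
have z0 : 0 < z by [].
have zx : z < x by near: z; exact: nbhs_right_lt.
rewrite -mulNr; apply: ler_pM.
- by rewrite oppr_ge0 ltW.
- by rewrite invr_ge0 ltW.
- by rewrite lerN2; exact/tangent_slope_nondecreasing/ltW.
- by rewrite lef_pV2 ?posrE ?w_gt0//; near: z.
Unshelve. all: by end_near. Qed.

Lemma dlog_le0_of_nondecreasing :
  (forall x y, 0 < x -> x <= y -> w x <= w y) -> L <= 0.
Proof.
move=> wnd; apply: (cvgr_to_le dlog_cvg); near=> z.
have z0 : 0 < z by [].
rewrite oppr_le0 divr_ge0 ?(ltW (w_gt0 _))// leNgt; apply/negP => dz.
have z20 : 0 < z / 2 by rewrite divr_gt0.
have zz : z / 2 < z by lra.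
by have := slope_lt0_decrease z20 zz dz; rewrite ltNge wnd// ltW.
Unshelve. all: by end_near. Qed.

(** Near 0 the slope of [ln w] is negative, hence so is the slope of [w]. *)
Lemma decreasing_of_dlog_gt0 : 0 < L -> exists2 eps, 0 < eps &
  forall x y, 0 < x -> x < y -> y < eps -> w y < w x.
Proof.
move=> L0; have [eps eps0 H] := near_right0_itv (cvgr_gt L dlog_cvg _ L0).
exists eps => // x y x0 xy ye.
have y0 := lt_trans x0 xy.
apply: slope_lt0_decrease => //; have := H y y0 ye.
by rewrite oppr_gt0 pmulr_llt0 ?invr_gt0// w_gt0.
Qed.

End supporting_lines.

(** * Comparing probabilities through densities *)

Section positive_integrand.
Context (R : realType) (d : measure_display) (T : measurableType d).
Context (m : {measure set T -> \bar R}) (A : set T) (p : T -> R).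
Hypothesis A_meas : measurable A.
Hypothesis p_meas : measurable_fun A p.
Hypothesis p_ge0 : forall x, A x -> 0 <= p x.

Lemma integral_gt0_of_pos : (0 < m A)%E -> (forall x, A x -> 0 < p x) ->
  (0 < \int[m]_(x in A) (p x)%:E)%E.
Proof.
move=> mA p0; rewrite lt0e integral_ge0; last first.
  by move=> x Ax; rewrite lee_fin p_ge0.
rewrite andbT; apply/negP => /eqP int0.
have : (\int[m]_(x in A) `|(p x)%:E| = 0)%E.
  rewrite -[RHS]int0; apply: eq_integral => x /set_mem Ax.
  by rewrite gee0_abs// lee_fin p_ge0.
have mp : measurable_fun A (EFin \o p) by exact/measurable_EFinP.
move=> /(ae_eq_integral_abs m A_meas mp).1 [N [mN N0 /= sub]].
have : (m A <= m N)%E.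
  apply: le_measure; rewrite ?inE// => x Ax; apply: sub => /= /(_ Ax) [] /eqP.
  by rewrite gt_eqF// p0.
by rewrite N0 leNgt mA.
Qed.

End positive_integrand.

Section scaled_density.
Context (R : realType) (d : measure_display) (Omega : measurableType d).
Context (P : probability Omega R) (X : {RV P >-> R}) (p : R -> R) (A : set R).
Hypothesis p_meas : measurable_fun [set: R] p.
Hypothesis p_ge0 : forall x, 0 <= p x.
Hypothesis X_pdf : has_pdf X p.
Hypothesis A_meas : measurable A.

Lemma measurable_scaled_density (a : R) :
  measurable_fun A (fun x => (a * p x)%:E).
Proof.
by apply/measurable_EFinP/measurable_funM => //; exact: measurable_funTS.
Qed.

Lemma scaled_prob_integral (a : R) : 0 <= a ->
  (a * fine (distribution P X A))%:E =
  (\int[@lebesgue_measure R]_(x in A) (a * p x)%:E)%E.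
Proof.
move=> a0; rewrite EFinM fineK ?fin_num_measure// X_pdf//.
rewrite -ge0_integralZl//.
- exact/measurable_EFinP/measurable_funTS.
- by move=> x _; rewrite lee_fin.
Qed.

End scaled_density.

Section density_comparison.
Context (R : realType) (d1 d2 : measure_display).
Context (Omega1 : measurableType d1) (Omega2 : measurableType d2).
Context (P1 : probability Omega1 R) (P2 : probability Omega2 R).
Context (X : {RV P1 >-> R}) (Y : {RV P2 >-> R}) (p q : R -> R).
Hypothesis p_meas : measurable_fun [set: R] p.
Hypothesis q_meas : measurable_fun [set: R] q.
Hypothesis p_ge0 : forall x, 0 <= p x.
Hypothesis q_ge0 : forall x, 0 <= q x.
Hypothesis X_pdf : has_pdf X p.
Hypothesis Y_pdf : has_pdf Y q.
Context (A : set R) (a c : R).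
Hypothesis A_meas : measurable A.
Hypothesis a_ge0 : 0 <= a.
Hypothesis c_ge0 : 0 <= c.

Lemma prob_le : (forall x, A x -> a * p x <= c * q x) ->
  a * fine (distribution P1 X A) <= c * fine (distribution P2 Y A).
Proof.
move=> pq; rewrite -lee_fin (scaled_prob_integral p_meas p_ge0 X_pdf)//.
rewrite (scaled_prob_integral q_meas q_ge0 Y_pdf)//.
apply: ge0_le_integral => //.
- by move=> x _; rewrite lee_fin mulr_ge0.
- exact: measurable_scaled_density.
- exact: measurable_scaled_density.
Qed.

(** The difference of the two scaled densities is nonnegative on [A] and has a
positive integral over [B], a set of positive length. *)
Lemma prob_lt (B : set R) : measurable B -> B `<=` A ->
  (0 < lebesgue_measure B)%E ->
  (forall x, A x -> a * p x <= c * q x) ->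
  (forall x, B x -> a * p x < c * q x) ->
  a * fine (distribution P1 X A) < c * fine (distribution P2 Y A).
Proof.
move=> B_meas BA B0 pq pqB; pose r x := c * q x - a * p x.
have r_ge0 x : A x -> 0 <= r x by move=> Ax; rewrite subr_ge0 pq.
have mr : measurable_fun [set: R] r.
  by apply: measurable_funB; apply: measurable_funM.
have r_gt0 : (0 < \int[@lebesgue_measure R]_(x in A) (r x)%:E)%E.
  apply: (@lt_le_trans _ _ (\int[@lebesgue_measure R]_(x in B) (r x)%:E)%E).
    apply: integral_gt0_of_pos => //; first exact: measurable_funTS.
    - by move=> x /BA /r_ge0.
    - by move=> x Bx; rewrite subr_gt0 pqB.
  by apply: ge0_subset_integral => //; exact/measurable_EFinP/measurable_funTS.
rewrite -lte_fin (scaled_prob_integral q_meas q_ge0 Y_pdf)//.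
have -> : (\int[@lebesgue_measure R]_(x in A) (c * q x)%:E =
    \int[@lebesgue_measure R]_(x in A) ((a * p x)%:E + (r x)%:E))%E.
  by apply: eq_integral => x _; rewrite -EFinD /r addrC subrK.
rewrite ge0_integralD//; last 3 first.
- by move=> x _; rewrite lee_fin mulr_ge0.
- exact: measurable_scaled_density.
- exact/measurable_EFinP/measurable_funTS.
by rewrite -(scaled_prob_integral p_meas p_ge0 X_pdf)// lteDl.
Qed.

End density_comparison.

(** * The mixture density relative to a member of the family *)

Definition param_diff (R : realType) (T : Type) (b : T -> R)
    (theta t : T) : R :=
  b t - b theta.

Definition weight_quot (R : realType) (T : Type) (h : T -> R)
    (theta t : T) : R :=
  h t / h theta.

Section exponential_family.
Context (R : realType) (d : measure_display) (Theta : measurableType d).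
Context (mu : probability Theta R) (f0 : R -> R) (b h : Theta -> R).
Hypothesis b_meas : measurable_fun [set: Theta] b.
Hypothesis h_meas : measurable_fun [set: Theta] h.
Hypothesis f0_gt0 : forall x : R, 0 < x -> 0 < f0 x.
Hypothesis f0_eq0 : forall x : R, x <= 0 -> f0 x = 0.
Hypothesis h_gt0 : forall t : Theta, 0 < h t.
Hypothesis f_pdf : forall t : Theta, is_pdf (expfam f0 b h t).
Context (theta : Theta).

Local Notation f := (expfam f0 b h theta).
Local Notation g := (mixture mu (expfam f0 b h)).
Local Notation c := (param_diff b theta).
Local Notation k := (weight_quot h theta).
Local Notation e := (tilt c k).
Local Notation w := (tilt_integral mu c k).

Let f_ge0 x : 0 <= f x. Proof. by have [] := f_pdf theta. Qed.

Let f_meas : measurable_fun [set: R] f. Proof. by have [] := f_pdf theta. Qed.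

Lemma expfam_gt0 (x : R) : 0 < x -> 0 < f x.
Proof.
by move=> x0; rewrite /expfam !mulr_gt0 ?expR_gt0 ?f0_gt0.
Qed.

Lemma measurable_param_diff : measurable_fun [set: Theta] c.
Proof. by apply: measurable_funB => //; exact: measurable_cst. Qed.

Lemma measurable_weight_quot : measurable_fun [set: Theta] k.
Proof. by apply: measurable_funM => //; exact: measurable_cst. Qed.

Lemma weight_quot_gt0 t : 0 < k t.
Proof. by rewrite divr_gt0. Qed.

Lemma expfamE t x : expfam f0 b h t x = f x * e x t.
Proof.
rewrite /f /e /c /k /expfam.
have -> : b t * x = b theta * x + (b t - b theta) * x by ring.
by rewrite expRD; field; rewrite gt_eqF.
Qed.

Let psi (z : R * Theta) : \bar R := (expfam f0 b h z.2 z.1)%:E.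

Let psi_ge0 z : (0 <= psi z)%E.
Proof. by rewrite lee_fin; have [] := f_pdf z.2. Qed.

Let measurable_psi : measurable_fun [set: R * Theta] psi.
Proof.
rewrite /psi; apply/measurable_EFinP.
under eq_fun do rewrite expfamE.
apply: measurable_funM; first exact: measurableT_comp.
apply: measurable_funM; last exact: (measurableT_comp measurable_weight_quot).
apply: measurableT_comp => //; apply: measurable_funM => //.
exact: (measurableT_comp measurable_param_diff).
Qed.

(** By Tonelli's theorem, since every member of the family has total mass 1. *)
Lemma integral_mixture :
  (\int[@lebesgue_measure R]_x \int[mu]_t (expfam f0 b h t x)%:E = 1)%E.
Proof.
transitivity (\int[mu]_t \int[@lebesgue_measure R]_x psi (x, t))%E.
  exact: (@fubini_tonelli _ _ (measurableTypeR R) Theta R lebesgue_measure mu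
    psi measurable_psi psi_ge0).
rewrite (eq_integral (cst 1%E)); last by move=> t _ /=; have [] := f_pdf t.
by rewrite integral_cst// mul1e; exact: probability_setT.
Qed.

Lemma measurable_mixture : measurable_fun [set: R] g.
Proof.
apply: (measurableT_comp (@fine_measurable R _ measurableT)).
exact: (measurable_fun_fubini_tonelli_F psi).
Qed.

(** The mixture integral is finite at almost every point because its integral
over the line is 1, and an interval of positive length is not negligible. *)
Lemma ex_integrable_tilt (x y : R) : 0 <= x -> x < y ->
  exists2 z, x < z < y & mu.-integrable [set: Theta] (EFin \o e z).
Proof.
move=> x0 xy; apply: contrapT => noz.
pose W (z : R) := (\int[mu]_t (expfam f0 b h t z)%:E)%E.
have W_int : (@lebesgue_measure R).-integrable [set: R] W.
  apply/integrableP; split; first exact: (measurable_fun_fubini_tonelli_F psi).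
  suff -> : (\int[@lebesgue_measure R]_z `|W z| = 1)%E by rewrite ltry.
  rewrite -integral_mixture; apply: eq_integral => z _.
  by rewrite gee0_abs// integral_ge0// => t _; exact: (psi_ge0 (z, t)).
have [N [mN N0 /= sub]] := integrable_ae measurableT W_int.
have : (lebesgue_measure `]x, y[%classic <= lebesgue_measure N)%E.
  apply: le_measure; rewrite ?inE// => z /=; rewrite in_itv /= => xzy.
  apply: sub => /= /(_ I) Wz; apply: noz; exists z => //.
  have fz : 0 < f z.
    by case/andP: xzy => xz _; exact/expfam_gt0/(le_lt_trans x0).
  apply/integrableP; split.
    apply/measurable_EFinP/measurable_tilt.
      exact: measurable_param_diff.
    exact: measurable_weight_quot.
  have : ((f z)%:E * \int[mu]_t `|(EFin \o e z) t| = W z)%E.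
    rewrite -ge0_integralZl//; last 2 first.
    - apply: measurableT_comp => //; apply/measurable_EFinP/measurable_tilt.
        exact: measurable_param_diff.
      exact: measurable_weight_quot.
    - by rewrite lee_fin.
    apply: eq_integral => t _; rewrite (expfamE t) EFinM /= ger0_norm//.
    exact/ltW/tilt_gt0/weight_quot_gt0.
  rewrite ltNge leye_eq; apply: contra_eqN => /eqP ->.
  rewrite gt0_muley ?lte_fin//; apply/eqP => Wy.
  by rewrite -Wy in Wz.
rewrite N0 lebesgue_measure_itv /= lte_fin xy -EFinD lee_fin subr_le0.
by rewrite leNgt xy.
Qed.

Lemma integrable_tilt (x : R) : 0 < x ->
  mu.-integrable [set: Theta] (EFin \o e x).
Proof.
move=> x0; have [y /andP[y0 yx] iy] := ex_integrable_tilt (lexx 0) x0.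
have x1 : x < x + 1 by rewrite ltrDl.
have [z /andP[xz _] iz] := ex_integrable_tilt (ltW x0) x1.
apply: (integrable_tilt_itv _ _ _ (ltW yx) (ltW xz) iy iz).
- exact: measurable_param_diff.
- exact: measurable_weight_quot.
- exact: weight_quot_gt0.
Qed.

(** For [x <= 0] both sides vanish, whatever the integral on the right is. *)
Lemma mixtureE (x : R) : g x = f x * w x.
Proof.
rewrite /mixture /tilt_integral; under eq_Rintegral do rewrite expfamE.
have [x0|x0] := leP x 0; last first.
  by rewrite RintegralZl//; exact: integrable_tilt.
have -> : f x = 0 by rewrite /expfam f0_eq0// !mul0r.
rewrite mul0r; under eq_Rintegral do rewrite mul0r.
by rewrite Rintegral_cst// mul0r.
Qed.

Lemma tilt_integral_gt0 (x : R) : 0 < x -> 0 < w x.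
Proof.
move=> x0; rewrite /tilt_integral /Rintegral fine_gt0//; apply/andP; split.
  apply: integral_gt0_of_pos => //.
  - apply: measurable_tilt; first exact: measurable_param_diff.
    exact: measurable_weight_quot.
  - by move=> t _; exact/ltW/tilt_gt0/weight_quot_gt0.
  - by have := @probability_setT _ _ _ mu => /= ->.
  - by move=> t _; exact/tilt_gt0/weight_quot_gt0.
exact/integrable_lty/integrable_tilt.
Qed.

End exponential_family.

(** * The stochastic orders in terms of the ratio of densities *)

Lemma fine_ccdf (R : realType) (d : measure_display) (T : measurableType d)
  (P : probability T R) (Z : {RV P >-> R}) x :
  fine (ccdf Z x) = 1 - fine (cdf Z x).
Proof. by rewrite ccdf_1_cdf fineB// fin_num_measure. Qed.

Lemma subset_itv0o_itvNyc (R : realType) (x : R) :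
  `]0, x[%classic `<=` (`]-oo, x]%classic : set R).
Proof. by move=> y /=; rewrite !in_itv /= => /andP[_ /ltW]. Qed.

Lemma lebesgue_measure_itv0o_gt0 (R : realType) (x : R) : 0 < x ->
  (0 < lebesgue_measure (`]0%R, x[%classic : set R))%E.
Proof.
by move=> x0; rewrite lebesgue_measure_itv /= lte_fin x0 sube0 lte_fin.
Qed.

Section positive_density.
Context (R : realType) (d : measure_display) (Omega : measurableType d).
Context (P : probability Omega R) (X : {RV P >-> R}) (p : R -> R).
Hypothesis p_meas : measurable_fun [set: R] p.
Hypothesis p_ge0 : forall x, 0 <= p x.
Hypothesis p_gt0 : forall x : R, 0 < x -> 0 < p x.
Hypothesis X_pdf : has_pdf X p.

Lemma cdf_gt0 (x : R) : 0 < x -> 0 < fine (cdf X x).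
Proof.
move=> x0; rewrite -(mul0r (fine (cdf X x))) -[ltRHS]mul1r.
apply: (prob_lt p_meas p_meas p_ge0 p_ge0 X_pdf X_pdf _ _ _ _
  (@subset_itv0o_itvNyc _ x)) => //.
- exact: lebesgue_measure_itv0o_gt0.
- by move=> y _; rewrite mul0r mul1r.
- by move=> y /=; rewrite in_itv /= => /andP[y0 _]; rewrite mul0r mul1r p_gt0.
Qed.

Lemma ccdf_gt0 (x : R) : 0 < x -> 0 < fine (ccdf X x).
Proof.
move=> x0; rewrite -(mul0r (fine (ccdf X x))) -[ltRHS]mul1r.
apply: (prob_lt p_meas p_meas p_ge0 p_ge0 X_pdf X_pdf _ _ _ _
  (@subset_refl _ _)) => //.
- by rewrite lebesgue_measure_itv /= ltry addye.
- by move=> y _; rewrite mul0r mul1r.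
- move=> y /=; rewrite in_itv /= andbT => xy.
  by rewrite mul0r mul1r p_gt0// (lt_trans x0).
Qed.

End positive_density.

Section orders_from_ratio.
Context (R : realType) (d1 d2 : measure_display).
Context (Omega1 : measurableType d1) (Omega2 : measurableType d2).
Context (P1 : probability Omega1 R) (P2 : probability Omega2 R).
Context (X : {RV P1 >-> R}) (Y : {RV P2 >-> R}) (f g w : R -> R).
Hypothesis f_meas : measurable_fun [set: R] f.
Hypothesis g_meas : measurable_fun [set: R] g.
Hypothesis f_gt0 : forall x : R, 0 < x -> 0 < f x.
Hypothesis f_eq0 : forall x : R, x <= 0 -> f x = 0.
Hypothesis w_gt0 : forall x : R, 0 < x -> 0 < w x.
Hypothesis gE : forall x : R, g x = f x * w x.
Hypothesis X_pdf : has_pdf X f.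
Hypothesis Y_pdf : has_pdf Y g.

Let F x := fine (cdf X x).
Let G x := fine (cdf Y x).
Let F' x := fine (ccdf X x).
Let G' x := fine (ccdf Y x).

Let f_ge0 x : 0 <= f x.
Proof. by have [/f_eq0->//|/f_gt0/ltW] := leP x 0. Qed.

Let g_gt0 x : 0 < x -> 0 < g x.
Proof. by move=> x0; rewrite gE mulr_gt0 ?f_gt0 ?w_gt0. Qed.

Let g_eq0 x : x <= 0 -> g x = 0.
Proof. by move=> x0; rewrite gE f_eq0// mul0r. Qed.

Let g_ge0 x : 0 <= g x.
Proof. by have [/g_eq0->//|/g_gt0/ltW] := leP x 0. Qed.

Let F_gt0 x : 0 < x -> 0 < F x. Proof. exact: cdf_gt0 X_pdf x. Qed.

Let G_gt0 x : 0 < x -> 0 < G x. Proof. exact: cdf_gt0 Y_pdf x. Qed.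

Let F'_gt0 x : 0 < x -> 0 < F' x. Proof. exact: ccdf_gt0 X_pdf x. Qed.

Let G'_gt0 x : 0 < x -> 0 < G' x. Proof. exact: ccdf_gt0 Y_pdf x. Qed.

Lemma st_leE : st_le X Y <-> forall x, F' x <= G' x.
Proof.
by split=> H x; have := H x; rewrite /F' /G' -lee_fin !fineK// fin_num_measure.
Qed.

Lemma hr_leE : hr_le X f Y g <-> forall x, 0 < x -> w x * F' x <= G' x.
Proof.
suff E x : 0 < x ->
    (g x / fine (ccdf Y x) <= f x / fine (ccdf X x)) = (w x * F' x <= G' x).
  by split=> H x x0; have := H x x0; rewrite E.
move=> x0; rewrite ler_pdivrMr ?G'_gt0// mulrAC ler_pdivlMr ?F'_gt0//.
by rewrite gE -mulrA ler_pM2l// f_gt0.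
Qed.

Lemma rh_leE : rh_le X f Y g <-> forall x, 0 < x -> G x <= w x * F x.
Proof.
suff E x : 0 < x ->
    (f x / fine (cdf X x) <= g x / fine (cdf Y x)) = (G x <= w x * F x).
  by split=> H x x0; have := H x x0; rewrite E.
move=> x0; rewrite ler_pdivrMr ?F_gt0// mulrAC ler_pdivlMr ?G_gt0//.
by rewrite gE -mulrA ler_pM2l// f_gt0.
Qed.

Lemma lr_leE : lr_le f g <-> forall x y, 0 < x -> x <= y -> w x <= w y.
Proof.
have E x : 0 < x -> f x / g x = (w x)^-1.
  by move=> x0; rewrite gE; field; rewrite !gt_eqF ?f_gt0 ?w_gt0.
split=> [H x y x0 xy|H x y]; last first.
  rewrite !in_itv /= !andbT => x0 y0 xy; rewrite !E//.
  by rewrite lef_pV2 ?posrE ?w_gt0//; exact: H.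
have y0 := lt_le_trans x0 xy.
have := H x y; rewrite !in_itv /= !andbT => /(_ x0 y0 xy).
by rewrite !E// lef_pV2 ?posrE ?w_gt0.
Qed.

(** Here [g <= f] on the left of [x], so [G x <= F x]. *)
Lemma ccdf_le_of_ratio_le1 x : (forall z, 0 < z -> z <= x -> w z <= 1) ->
  F' x <= G' x.
Proof.
move=> w1; rewrite /F' /G' !fine_ccdf lerB//.
rewrite -[leLHS]mul1r -[leRHS]mul1r.
apply: (prob_le g_meas f_meas g_ge0 f_ge0 Y_pdf X_pdf) => // z /=.
rewrite in_itv /= !mul1r => zx.
have [z0|z0] := leP z 0; first by rewrite g_eq0.
by rewrite gE ler_piMr// w1.
Qed.

Lemma ccdf_le_of_ratio_ge x a : 0 <= a ->
  (forall y, x < y -> 0 < y -> a <= w y) -> a * F' x <= G' x.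
Proof.
move=> a0 aw; rewrite -[leRHS]mul1r.
apply: (prob_le f_meas g_meas f_ge0 g_ge0 X_pdf Y_pdf) => // y /=.
rewrite in_itv /= andbT mul1r => xy.
have [y0|y0] := leP y 0; first by rewrite f_eq0// g_eq0// mulr0.
by rewrite gE mulrC ler_wpM2l// aw.
Qed.

(** Both orders at [x] follow from a lower bound of [w] on the right of [x]
(1, respectively [w x]), if it holds. Otherwise a later value of [w] below that
bound forces [w <= 1] on the left of [x], and then [F' x <= G' x]. *)
Lemma st_hr_of_le_max :
  (forall z y, 0 < z -> z < y -> w z <= Num.max 1 (w y)) ->
  st_le X Y /\ hr_le X f Y g.
Proof.
move=> wmax; split.
  rewrite st_leE => x.
  have [H|] := pselect (forall y, x < y -> 0 < y -> 1 <= w y).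
    by rewrite -(mul1r (F' x)); exact: ccdf_le_of_ratio_ge.
  move=> /existsNP[y /not_implyP[xy /not_implyP[y0 /negP]]].
  rewrite -ltNge => wy.
  apply: ccdf_le_of_ratio_le1 => z z0 zx.
  by have := wmax _ _ z0 (le_lt_trans zx xy); rewrite (max_l (ltW wy)).
rewrite hr_leE => x x0.
have [H|] := pselect (forall y, x < y -> 0 < y -> w x <= w y).
  by apply: ccdf_le_of_ratio_ge => //; exact/ltW/w_gt0.
move=> /existsNP[y /not_implyP[xy /not_implyP[y0 /negP]]].
rewrite -ltNge => wyx.
have wx1 : w x <= 1.
  by have := wmax _ _ x0 xy; rewrite le_max [w x <= w y]leNgt wyx orbF.
have w1 : F' x <= G' x.
  apply: ccdf_le_of_ratio_le1 => z z0 zx.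
  have := wmax _ _ z0 (le_lt_trans zx xy); rewrite max_l//.
  exact: le_trans (ltW wyx) wx1.
by apply: le_trans w1; rewrite ler_piMl// ltW// F'_gt0.
Qed.

(** For small [x] the mass of [g] on the left of [x] exceeds that of [f], so
that [G' x < F' x < w x * F' x]. *)
Lemma not_st_hr_of_near_gt1 : (\forall x \near 0^'+, 1 < w x) ->
  ~ st_le X Y /\ ~ hr_le X f Y g.
Proof.
move=> /near_right0_itv[eps eps0 w1].
pose x := eps / 2; have x0 : 0 < x by rewrite divr_gt0.
have xe : x < eps by rewrite /x; lra.
have GF : G' x < F' x.
  rewrite /F' /G' !fine_ccdf ltrD2l ltrN2 -[ltLHS]mul1r -[ltRHS]mul1r.
  apply: (prob_lt f_meas g_meas f_ge0 g_ge0 X_pdf Y_pdf _ _ _ _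
    (@subset_itv0o_itvNyc _ x)) => //.
  - exact: lebesgue_measure_itv0o_gt0.
  - move=> y /=; rewrite in_itv /= !mul1r => yx.
    have [y0|y0] := leP y 0; first by rewrite f_eq0.
    by rewrite gE ler_peMr// ltW// w1// (le_lt_trans yx).
  - move=> y /=; rewrite in_itv /= !mul1r => /andP[y0 yx].
    by rewrite gE ltr_pMr ?f_gt0// w1// (lt_trans yx).
split=> [/st_leE/(_ x)|/hr_leE/(_ x x0)]; first by rewrite leNgt GF.
have := w1 _ x0 xe; have := F'_gt0 x0; nra.
Qed.

Lemma rh_of_nondecreasing : (forall x y, 0 < x -> x <= y -> w x <= w y) ->
  rh_le X f Y g.
Proof.
move=> wnd; rewrite rh_leE => x x0; rewrite -[leLHS]mul1r.
apply: (prob_le g_meas f_meas g_ge0 f_ge0 Y_pdf X_pdf) => //.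
  exact/ltW/w_gt0.
move=> y /=; rewrite in_itv /= mul1r => yx.
have [y0|y0] := leP y 0; first by rewrite g_eq0// f_eq0// mulr0.
by rewrite gE mulrC ler_wpM2r// wnd.
Qed.

(** Near 0 the values of [w] on the left of [x] exceed [w x], so integrating
[w x * f < w * f = g] gives [w x * F x < G x]. *)
Lemma not_rh_of_decreasing (eps : R) : 0 < eps ->
  (forall x y, 0 < x -> x < y -> y < eps -> w y < w x) -> ~ rh_le X f Y g.
Proof.
move=> eps0 wdec; pose x := eps / 2.
have x0 : 0 < x by rewrite divr_gt0.
have xe : x < eps by rewrite /x; lra.
rewrite rh_leE => /(_ x x0); apply/negP; rewrite -ltNge -[ltRHS]mul1r.
apply: (prob_lt f_meas g_meas f_ge0 g_ge0 X_pdf Y_pdf _ _ _ _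
  (@subset_itv0o_itvNyc _ x)) => //.
- exact/ltW/w_gt0.
- exact: lebesgue_measure_itv0o_gt0.
- move=> y /=; rewrite in_itv /= !mul1r => yx.
  have [y0|y0] := leP y 0; first by rewrite f_eq0// g_eq0// mulr0.
  rewrite gE mulrC ler_wpM2l//.
  by move: yx; rewrite le_eqVlt => /predU1P[->//|yx]; exact/ltW/wdec.
- move=> y /=; rewrite in_itv /= !mul1r => /andP[y0 yx].
  by rewrite gE mulrC ltr_pM2l ?f_gt0//; exact: wdec.
Qed.

End orders_from_ratio.

(** * The ordering theorem *)

Theorem mainTheorem5 (R : realType)
  (d : measure_display) (Theta : measurableType d) (mu : probability Theta R)
  (f0 : R -> R) (b h : Theta -> R)
  (b_meas : measurable_fun [set: Theta] b)
  (h_meas : measurable_fun [set: Theta] h)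
  (f0_gt0 : forall x : R, 0 < x -> 0 < f0 x)
  (f0_eq0 : forall x : R, x <= 0 -> f0 x = 0)
  (h_gt0 : forall t : Theta, 0 < h t)
  (f_pdf : forall t : Theta, is_pdf (expfam f0 b h t))
  (theta : Theta)
  (d1 : measure_display) (Omega1 : measurableType d1)
  (P1 : probability Omega1 R) (X : {RV P1 >-> R})
  (d2 : measure_display) (Omega2 : measurableType d2)
  (P2 : probability Omega2 R) (Y : {RV P2 >-> R})
  (X_pdf : has_pdf X (expfam f0 b h theta))
  (Y_pdf : has_pdf Y (mixture mu (expfam f0 b h))) :
  let f := expfam f0 b h theta in
  let g := mixture mu (expfam f0 b h) in
  let l := logratio f g in
  ((l x)%:E @[x --> 0^'+] -->
      (- lne (\int[mu]_t (h t / h theta)%:E))%E ->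
    (st_le X Y <-> (\int[mu]_t (h t)%:E <= (h theta)%:E)%E) /\
    (hr_le X f Y g <-> (\int[mu]_t (h t)%:E <= (h theta)%:E)%E))
  /\
  ((\int[mu]_t (h t)%:E < +oo)%E ->
    (\int[mu]_t (`|b t| * h t)%:E < +oo)%E ->
    derive1 l x @[x --> 0^'+] -->
      (\int[mu]_t ((b theta - b t) * h t)) / (\int[mu]_t h t) ->
    (lr_le f g <->
      b theta <= (\int[mu]_t (b t * h t)) / (\int[mu]_t h t)) /\
    (rh_le X f Y g <->
      b theta <= (\int[mu]_t (b t * h t)) / (\int[mu]_t h t))).
Proof.
move=> f g l.
pose c := param_diff b theta.
pose k := weight_quot h theta.
pose w := tilt_integral mu c k.
pose dw := tilt_slope mu c k.
have c_meas : measurable_fun [set: Theta] c by exact: measurable_param_diff.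
have k_meas : measurable_fun [set: Theta] k by exact: measurable_weight_quot.
have k_gt0 t : 0 < k t by exact: weight_quot_gt0.
have e_int (x : R) : 0 < x ->
    mu.-integrable [set: Theta] (EFin \o tilt c k x).
  exact: (integrable_tilt mu b_meas h_meas f0_gt0).
have w_gt0 (x : R) : 0 < x -> 0 < w x.
  exact: (tilt_integral_gt0 mu b_meas h_meas f0_gt0).
have gE x : g x = f x * w x by exact: mixtureE.
have g_meas : measurable_fun [set: R] g by exact: measurable_mixture.
have f_meas : measurable_fun [set: R] f by have [] := f_pdf theta.
have f_gt0 (x : R) : 0 < x -> 0 < f x by exact: expfam_gt0.
have f_eq0 (x : R) : x <= 0 -> f x = 0.
  by move=> x0; rewrite /f /expfam f0_eq0// !mul0r.
have tangent (x y : R) : 0 < x -> 0 < y -> w x + dw x * (y - x) <= w y.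
  exact: tilt_integral_tangent.
have lE (x : R) : 0 < x -> l x = - ln (w x).
  move=> x0; rewrite /l /logratio gE invfM mulrA divff ?gt_eqF ?f_gt0// mul1r.
  by rewrite lnV// posrE w_gt0.
split.
  (* [w0] is the limit of [w] at 0, possibly +oo. *)
  move=> l_cvg; set w0 := (\int[mu]_t (h t / h theta)%:E)%E in l_cvg.
  have w0E : (w0 <= 1)%E = (\int[mu]_t (h t)%:E <= (h theta)%:E)%E.
    rewrite /w0; under eq_integral do rewrite EFinM.
    rewrite ge0_integralZr//.
    - by rewrite lee_pdivrMr// mul1e.
    - exact/measurable_EFinP.
    - by move=> t _; rewrite lee_fin ltW.
    - by rewrite lee_fin invr_ge0 ltW.
  rewrite -w0E; have [w01|w01] := leP w0 1%E.
    have [st hr] : st_le X Y /\ hr_le X f Y g.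
      apply: (@st_hr_of_le_max _ _ _ _ _ _ _ _ _ _ _ w) => //.
      move=> z y z0 zy; apply: (le_max_of_near_le tangent) => // M M1 wM.
      have : (- lne w0 <= (- ln M)%:E)%E.
        apply: (cvge_to_le l_cvg); near=> x.
        have x0 : 0 < x by [].
        have M0 : 0 < M := lt_trans ltr01 M1.
        rewrite lee_fin lE// lerN2 ler_ln ?posrE ?w_gt0//.
        by near: x.
      rewrite leNgt => /negP; apply; apply: (@lt_le_trans _ _ 0%E).
        by rewrite lte_fin oppr_lt0 ln_gt0.
      by rewrite oppe_ge0 lne_le0.
    by split; split.
  have [st hr] : ~ st_le X Y /\ ~ hr_le X f Y g.
    apply: (@not_st_hr_of_near_gt1 _ _ _ _ _ _ _ _ _ _ _ w) => //.
    have Nl : (- lne w0 < 0)%E by rewrite oppe_lt0 lne_gt0.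
    have l_lt0 : \forall x \near 0^'+, ((l x)%:E < 0)%E.
      exact: l_cvg (open_ereal_lt' Nl).
    near=> x; have x0 : 0 < x by [].
    have : ((l x)%:E < 0)%E by near: x.
    rewrite lte_fin lE// oppr_lt0 => lnw; rewrite ltNge; apply/negP => /ln_le0.
    by rewrite leNgt lnw.
  by split; split.
move=> h_fin bh_fin dl_cvg.
set Ih := \int[mu]_t h t in dl_cvg *.
set L := _ / Ih in dl_cvg.
have h_int : mu.-integrable [set: Theta] (EFin \o h).
  apply/integrableP; split; first exact/measurable_EFinP.
  rewrite (eq_integral (fun t => (h t)%:E))// => t _ /=.
  by rewrite gtr0_norm.
have bh_int : mu.-integrable [set: Theta] (EFin \o (fun t => b t * h t)).
  apply/integrableP; split; first exact/measurable_EFinP/measurable_funM.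
  rewrite (eq_integral (fun t => (`|b t| * h t)%:E))// => t _ /=.
  by rewrite normrM [`|h t|]gtr0_norm.
have Ih_gt0 : 0 < Ih.
  rewrite /Ih /Rintegral fine_gt0//; apply/andP.
  split; last exact: integrable_lty.
  apply: integral_gt0_of_pos => //.
  - by move=> t _; exact/ltW.
  - by have := @probability_setT _ _ _ mu => /= ->.
(* The sign of [L] is that of its numerator, which is linear in [b theta]. *)
have LE : (L <= 0) = (b theta <= (\int[mu]_t (b t * h t)) / Ih).
  have -> : L = (b theta * Ih - \int[mu]_t (b t * h t)) / Ih.
    rewrite /L /Ih -RintegralZl// -RintegralB//.
      by congr (_ / _); apply: eq_Rintegral => t _; rewrite mulrBl.
    have := integrableZl measurableT (b theta) h_int.
    by apply: eq_integrable => // t _ /=; rewrite EFinM.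
  by rewrite ler_pdivrMr// mul0r subr_le0 ler_pdivlMr.
(* [L] is the limit of the logarithmic derivative of [1 / w]. *)
have dlog_cvg : - (dw x / w x) @[x --> 0^'+] --> L.
  apply: cvg_trans dl_cvg; apply: near_eq_cvg; near=> x.
  have x0 : 0 < x by [].
  rewrite derive1E; apply/esym.
  have lE' : \forall y \near x, - ln (w y) = l y.
    near=> y; rewrite lE//; near: y; exact: lt_nbhsr.
  rewrite -(near_eq_derive _ lE').
  have dwx : is_derive x 1 w (dw x) by exact: is_derive_tilt_integral.
  have dln : is_derive (w x) 1 (@ln R) (w x)^-1.
    by apply: is_derive1_ln; exact: w_gt0.
  have := is_deriveN (is_derive1_comp dln dwx) => -[_ ->].
  by rewrite mulrC.
have w_bnd : \forall x \near 0^'+, w x <= \int[mu]_t k t + w 1.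
  apply: tilt_integral_bounded => //.
  have := integrableZr measurableT (h theta)^-1 h_int.
  by apply: eq_integrable => // t _ /=; rewrite EFinM.
rewrite -LE; split.
  rewrite (lr_leE f_gt0 w_gt0 gE); split.
    exact: (dlog_le0_of_nondecreasing tangent w_gt0 dlog_cvg).
  exact: (nondecreasing_of_dlog_le0 tangent w_gt0 dlog_cvg w_bnd).
split=> [rh|L0].
  rewrite leNgt; apply/negP => /(decreasing_of_dlog_gt0 tangent w_gt0 dlog_cvg).
  move=> [eps eps0 wdec].
  exact: (not_rh_of_decreasing f_meas g_meas f_gt0 f_eq0 w_gt0 gE X_pdf Y_pdf
    eps0 wdec rh).
apply: (rh_of_nondecreasing f_meas g_meas f_gt0 f_eq0 w_gt0 gE X_pdf Y_pdf).
exact: (nondecreasing_of_dlog_le0 tangent w_gt0 dlog_cvg w_bnd).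
Unshelve. all: by end_near. Qed.
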